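(* Let $G=(V,E)$ be a finite simple graph having a solution to the Edge-Vertex Problem, let $S$ be an optimal solution to the Minimum Edge-Vertex Problem for $G$, and let $G'=(V,S)$ be the spanning subgraph of $G$ with edge set $S$. Then $G'$ contains no cycle. Moreover, for each connected component $H$ of $G'$, the subgraph of $G$ induced by the vertex set $V(H)$ is a tree (namely $H$ itself).
   Context: For a graph $G=(V,E)$, a solution to the Edge-Vertex Problem is a subset $X\subseteq E$ such that for every vertex $v\in V$ the number of edges of $X$ incident with $v$ is odd. An optimal solution to the Minimum Edge-Vertex Problem is a solution of minimum cardinality. *)

(* Defs.v *)
From mathcomp Require Import all_boot.

Set Implicit Arguments.
Unset Strict Implicit.
Unset Printing Implicit Defensive.

(* The vertex set is a subset of the ambient finite type T, so that subgraphs
   of a graph are again graphs over T and can be compared by equality.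
   Edges are 2-element sets of vertices. *)
Record sgraph (T : finType) := SGraph {
  vertices : {set T};
  edges : {set {set T}};
  edgesP : edges \subset [set f : {set T} | f \subset vertices & #|f| == 2]
}.

Section Graphs.
Variable T : finType.
Implicit Types (G H K : sgraph T) (A : {set T}) (X Y S : {set {set T}}).

Definition adj G : rel T := fun x y => [set x; y] \in edges G.

Definition subgraph H G : bool :=
  (vertices H \subset vertices G) && (edges H \subset edges G).

(* The empty graph is not connected. *)
Definition connected G : Prop :=
  vertices G != set0 /\
  {in vertices G &, forall x y, connect (adj G) x y}.

(* A cycle is given by its cyclic sequence of at least 3 distinct vertices. *)
Definition has_cycle G : Prop :=
  exists c : seq T, 2 < size c /\ ucycle (adj G) c.

Definition is_tree G : Prop := connected G /\ ~ has_cycle G.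

Definition is_component H G : Prop :=
  [/\ subgraph H G, connected H
    & forall K, subgraph K G -> connected K -> subgraph H K -> K = H].

Lemma induced_edgesP G A :
  [set f in edges G | f \subset A] \subset
    [set f : {set T} | f \subset vertices G :&: A & #|f| == 2].
Proof.
apply/subsetP => f; rewrite !inE => /andP[fE fA].
have := subsetP (edgesP G) f fE; rewrite inE => /andP[fV ->].
by rewrite subsetI fV fA.
Qed.

Definition induced G A : sgraph T := SGraph (induced_edgesP G A).

Definition spanning_subgraph G S (sSE : S \subset edges G) : sgraph T :=
  @SGraph T (vertices G) S (subset_trans sSE (edgesP G)).

Definition is_solution G X : Prop :=
  X \subset edges G /\
  {in vertices G, forall v, odd #|[set f in X | v \in f]|}.

Definition is_optimal G X : Prop :=
  is_solution G X /\ forall Y, is_solution G Y -> #|X| <= #|Y|.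

Lemma optimal_sub G S : is_optimal G S -> S \subset edges G.
Proof. by case=> -[]. Qed.

End Graphs.

(* Main.v *)
(** A cycle of [G] meets every vertex in an even number of edges, so adding it
    modulo 2 to a solution gives another solution. If all edges of the cycle but
    at most one lie in an optimal solution [S], this strictly decreases the
    cardinality, a contradiction. A cycle of [G'] is such a cycle, and so is a
    path of [G'] closed by an edge of [G] outside [S], which rules out chords in
    the components of [G']. *)
Require Import Defs.
From mathcomp Require Import all_boot.

Definition symdiff {T : finType} (A B : {set T}) : {set T} :=
  (A :\: B) :|: (B :\: A).

Lemma card_symdiff (T : finType) (A B : {set T}) :
  #|symdiff A B| = #|A :\: B| + #|B :\: A|.
Proof.
have dAB : (A :\: B) :&: (B :\: A) = set0.
  by apply/setP => x; rewrite !inE; case: (x \in A); rewrite ?andbF.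
by rewrite cardsU dAB cards0 subn0.
Qed.

Lemma odd_card_symdiff (T : finType) (A B : {set T}) :
  odd #|symdiff A B| = odd #|A| (+) odd #|B|.
Proof.
(* The common part of [A] and [B] is counted once in each cardinality, so it cancels modulo 2. *)
rewrite card_symdiff -(cardsID B A) -(cardsID A B) setIC !oddD.
by case: (odd _); case: (odd _); case: (odd _).
Qed.

Lemma symdiff_filter (T : finType) (P : pred T) (A B : {set T}) :
  [set x in symdiff A B | P x] = symdiff [set x in A | P x] [set x in B | P x].
Proof.
apply/setP => x; rewrite !inE.
by case: (x \in A); case: (x \in B); case: (P x).
Qed.

Lemma set2_eqP {T : finType} {a b c d : T} :
  [set a; b] = [set c; d] -> a = c \/ a = d /\ b = c.
Proof.
move=> E.
have: a \in [set c; d] by rewrite -E set21.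
have: c \in [set a; b] by rewrite E set21.
by rewrite !inE => /orP[]/eqP ? /orP[]/eqP ?; auto.
Qed.

Lemma adjC (T : finType) (G : sgraph T) (x y : T) : adj G x y = adj G y x.
Proof. by rewrite /adj setUC. Qed.

Lemma subgraph_adj {T : finType} {H G : sgraph T} :
  subgraph H G -> subrel (adj H) (adj G).
Proof. by case/andP => _ /subsetP sE x y; apply: sE. Qed.

Lemma subgraph_has_cycle {T : finType} {H G : sgraph T} :
  subgraph H G -> has_cycle H -> has_cycle G.
Proof.
move=> sHG [c [c_gt2 /andP[Hc Uc]]]; exists c; split=> //.
by rewrite /ucycle Uc (sub_cycle (subgraph_adj sHG) Hc).
Qed.

Lemma sgraph_eq {T : finType} {G H : sgraph T} :
  vertices G = vertices H -> edges G = edges H -> G = H.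
Proof.
case: G H => [V E p] [W F q] /= eV eE; subst W F.
by rewrite (bool_irrelevance p q).
Qed.

(** After rotating [x] to the front, its second successor is the third entry, which differs from [x]
    because [c] has length at least 3. This excludes walking back along the same edge. *)
Lemma next_next_neq {T : eqType} {c : seq T} {x : T} :
  uniq c -> 2 < size c -> x \in c -> next c (next c x) != x.
Proof.
move=> Uc c_gt2 /rot_to[i c' rc].
have Ur : uniq (rot i c) by rewrite rot_uniq.
have: 2 < size (rot i c) by rewrite size_rot.
rewrite -!(next_rot i Uc); move: Ur; rewrite rc.
case: c' {rc} => [|y [|z s]] //= /and4P[+ + _ _] _.
rewrite !inE !negb_or => /and3P[xy xz _] _.
by rewrite eqxx [y == x]eq_sym (negPf xy) eqxx eq_sym.
Qed.

Lemma path_next {T : eqType} {e : rel T} {x : T} {p : seq T} {y : T} :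
  path e x p -> y \in x :: p -> y != last x p -> e y (next (x :: p) y).
Proof.
(* The successor of [y] is the entry of [p] at the index of [y] in [x :: p]. Only for the last entry
   does this index overrun [p], giving the default [x], which closes the cycle. *)
move=> /(pathP x) ep yp y_last; rewrite next_nth yp.
have ny := nth_index x yp.
rewrite -{1}ny; apply: ep.
have: index y (x :: p) <= size p by rewrite -ltnS; move: yp; rewrite -index_mem.
rewrite leq_eqVlt => /orP[/eqP i_last|//].
by case/eqP: y_last; rewrite -ny i_last -last_nth.
Qed.

(** The induced subgraph contains [H] on the same vertices, so it is connected, and maximality of
    [H] forces equality. *)
Lemma component_induced {T : finType} {K H : sgraph T} :
  is_component H K -> induced K (vertices H) = H.
Proof.
move=> [sHK [H0 cH] maxH]; have /andP[sV sE] := sHK.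
have vI : vertices (induced K (vertices H)) = vertices H by apply/setIidPr.
have sHI : subgraph H (induced K (vertices H)).
  rewrite /subgraph vI subxx /=; apply/subsetP => f fH.
  have := subsetP (edgesP H) f fH; rewrite !inE => /andP[-> _].
  by rewrite (subsetP sE).
apply: maxH => //.
- rewrite /subgraph vI sV; apply/subsetP => f.
  by rewrite inE => /andP[].
- split; rewrite vI // => x y xH yH.
  apply: connect_sub (cH x y xH yH) => a b ab.
  exact/connect1/(subgraph_adj sHI).
Qed.

Definition cycle_edges {T : finType} (c : seq T) : {set {set T}} :=
  [set [set x; next c x] | x in c].

Section CycleEdges.
Context {T : finType} {c : seq T}.
Hypotheses (Uc : uniq c) (c_gt2 : 2 < size c).

(** If distinct [x] and [y] gave the same edge, each would be the successor of the other. *)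
Lemma cycle_edge_inj : {in c &, injective (fun x => [set x; next c x])}.
Proof.
move=> x y xc yc /set2_eqP[//|[xE yE]].
by have := next_next_neq Uc c_gt2 xc; rewrite yE -xE eqxx.
Qed.

Lemma card_cycle_edges : #|cycle_edges c| = size c.
Proof. by rewrite card_in_imset ?(card_uniqP Uc) //; apply: cycle_edge_inj. Qed.

Lemma cycle_edges_even v : ~~ odd #|[set f in cycle_edges c | v \in f]|.
Proof.
have -> : [set f in cycle_edges c | v \in f] =
    [set [set x; next c x] | x in [set x in c | v \in [set x; next c x]]].
  apply/setP => f; rewrite inE; apply/andP/imsetP.
    by case=> /imsetP[x xc ->] vf; exists x; rewrite // inE xc.
  by case=> x; rewrite inE => /andP[xc vx] ->; split=> //; apply: imset_f.
(* By injectivity, it suffices to count the starting vertices of the edges at [v]: none if [v] is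
   off the cycle, otherwise [v] and its predecessor. *)
rewrite card_in_imset; last first.
  move=> x y; rewrite !inE => /andP[xc _] /andP[yc _].
  exact: cycle_edge_inj.
case vc: (v \in c); last first.
  rewrite (_ : [set _ in _ | _] = set0) ?cards0 //.
  apply/setP => x; rewrite !inE; apply/negP => /andP[xc /orP[]/eqP vE].
    by rewrite vE xc in vc.
  by rewrite vE mem_next xc in vc.
have -> : [set x in c | v \in [set x; next c x]] = [set v; prev c v].
  apply/setP => x; rewrite !inE.
  rewrite (eq_sym v x) -(can2_eq (prev_next Uc) (next_prev Uc)).
  rewrite (eq_sym v); case: (eqVneq x v) => [->|_] /=; first by rewrite vc.
  case: eqP => [xE|]; last by rewrite andbF.
  by rewrite andbT -(mem_next c) xE.
have vpv : v != prev c v.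
  apply/eqP => vE; have nv : next c v = v by rewrite {1}vE next_prev.
  by have := next_next_neq Uc c_gt2 vc; rewrite !nv eqxx.
by rewrite cards2 vpv.
Qed.

Lemma cycle_edges_sub {G : sgraph T} :
  cycle (adj G) c -> cycle_edges c \subset edges G.
Proof.
by move=> Gc; apply/subsetP => f /imsetP[x xc ->]; apply: (next_cycle Gc).
Qed.

End CycleEdges.

Lemma symdiff_solution {T : finType} {G : sgraph T} {X : {set {set T}}}
    {c : seq T} :
  is_solution G X -> 2 < size c -> ucycle (adj G) c ->
  is_solution G (symdiff X (cycle_edges c)).
Proof.
move=> [sXG oddX] c_gt2 /andP[Gc Uc]; split.
  rewrite subUset (subset_trans (subsetDl _ _) sXG) /=.
  exact: subset_trans (subsetDl _ _) (cycle_edges_sub Gc).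
move=> v vG; rewrite symdiff_filter odd_card_symdiff oddX //.
by rewrite (negPf (cycle_edges_even Uc c_gt2 v)).
Qed.

Section Optimal.
Context {T : finType} {G : sgraph T} {S : {set {set T}}}.
Hypothesis hS : is_optimal G S.
Let G' := spanning_subgraph (optimal_sub hS).

Lemma optimal_subgraph : subgraph G' G.
Proof. by rewrite /subgraph subxx (optimal_sub hS). Qed.

(** The closing edge is only required to lie in [G], so the lemma serves both for cycles of [G'] and
    for chords outside [S]. *)
Lemma optimal_path_not_closed {x : T} {p : seq T} :
  path (adj G') x p -> uniq (x :: p) -> 1 < size p ->
  ~~ adj G (last x p) x.
Proof.
move=> Sp Uc p_gt1; apply/negP => Gvx.
have c_gt2 : 2 < size (x :: p) by [].
have Gc : ucycle (adj G) (x :: p).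
  rewrite /ucycle Uc andbT /= rcons_path Gvx andbT.
  exact: sub_path (subgraph_adj optimal_subgraph) _ _ Sp.
set E := cycle_edges (x :: p).
(* Only the closing edge can lie outside [S]. *)
have E_S : #|E :\: S| <= 1.
  rewrite -(cards1 [set last x p; next (x :: p) (last x p)]).
  apply/subset_leq_card/subsetP => f; rewrite !inE => /andP[+ /imsetP[y yc fE]].
  rewrite fE; case: (eqVneq y (last x p)) => [-> _|yl] //.
  by rewrite (path_next Sp yc yl : _ \in S).
have := hS.2 _ (symdiff_solution hS.1 c_gt2 Gc).
(* Cancelling [S :\: E] in the minimality inequality leaves at most [#|E :\: S|], hence at most one,
   edge in [S :&: E]. So [E] would have at most 2 edges. *)
rewrite card_symdiff -/E -(cardsID E S) [X in X <= _]addnC leq_add2l => SE.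
have: 2 < #|E| by rewrite card_cycle_edges.
by rewrite -(cardsID S E) setIC ltnNge (leq_add (leq_trans SE E_S) E_S).
Qed.

Lemma optimal_acyclic : ~ has_cycle G'.
Proof.
case=> -[|x p] [//= p_gt1 /andP[/=]].
rewrite rcons_path => /andP[Sp Svx] Uc.
have := optimal_path_not_closed Sp Uc p_gt1.
by rewrite (subgraph_adj optimal_subgraph _ _ Svx).
Qed.

(** A simple path of [H] from [u] to [v] with two or more edges would be closed by the edge [uv] of
    [G]. So the path is that single edge, which therefore lies in [G']. *)
Lemma optimal_component_edges {H : sgraph T} {u v : T} :
  is_component H G' -> u \in vertices H -> v \in vertices H -> u != v ->
  adj G u v -> adj G' u v.
Proof.
move=> [sHG [_ cH] _] uH vH uv Guv.
have /connectP[q Hq vE] := cH u v uH vH.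
case/shortenP: Hq vE => p Hp Up _ vE.
have Sp := sub_path (subgraph_adj sHG) Hp.
case: p Sp Up vE {Hp} => [|w [|z p]] Sp Up vE.
- by rewrite vE eqxx in uv.
- by move: Sp; rewrite vE /= andbT.
- by have := optimal_path_not_closed Sp Up isT; rewrite -vE adjC Guv.
Qed.

Lemma optimal_component_induced {H : sgraph T} :
  is_component H G' -> induced G (vertices H) = H.
Proof.
(* Writing [H] as an induced subgraph of [G'] leaves only the edges of [G] and of [G'] inside
   [vertices H] to compare. *)
move=> cH; rewrite -[RHS](component_induced cH); apply: sgraph_eq => //=.
apply/setP => f; rewrite !inE; apply/andP/andP => -[fE fH]; split=> //; last first.
  exact: subsetP (optimal_sub hS) f fE.
have := subsetP (edgesP G) f fE; rewrite inE => /andP[_ /cards2P[u [v [uv fuv]]]].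
move: fE fH; rewrite {}fuv subUset !sub1set => fE /andP[uH vH].
exact: (optimal_component_edges cH uH vH uv fE).
Qed.

End Optimal.

Theorem theorem3p5 (T : finType) (G : sgraph T) (S : {set {set T}})
    (hG : exists X : {set {set T}}, is_solution G X)
    (hS : is_optimal G S) :
  let G' := spanning_subgraph (optimal_sub hS) in
  ~ has_cycle G' /\
  (forall H : sgraph T, is_component H G' ->
     is_tree (induced G (vertices H)) /\ induced G (vertices H) = H).
Proof.
move=> G'; split=> [|H cH]; first exact: optimal_acyclic.
rewrite (optimal_component_induced hS cH); split=> //.
case: cH => sHG cH _; split=> // Hc.
exact: (optimal_acyclic hS (subgraph_has_cycle sHG Hc)).
Qed.
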